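(* Let $n\geqslant 1$, let $T$ be a maximal torus of $SO_{2n}(\Bbbk)$ and $N(T)$ its normalizer in $SO_{2n}(\Bbbk)$. Encode the connected components of $N(T)$ by pairs $(\sigma,\theta)$ with $\sigma\in S_n$, $\theta=(\varepsilon_1,\ldots,\varepsilon_n)\in\{\pm1\}^n$, where the number of indices $j$ with $\varepsilon_j=-1$ is even. Let $\sigma=(i_{1,1},\ldots,i_{1,s_1})\cdots(i_{k,1},\ldots,i_{k,s_k})$ be the decomposition of $\sigma$ into a product of independent cycles (cycles of length $1$ included). Then the component corresponding to $(\sigma,\theta)$ is periodic if and only if $$\prod_{q=1}^{s_j}\varepsilon_{i_{j,q}}=-1\quad\text{for all } j=1,\ldots,k,$$ and in this case every element of the component has order $2\cdot\operatorname{lcm}(s_1,\ldots,s_k)$.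
   Context: $\Bbbk$ is an algebraically closed field of characteristic zero. A connected component of an affine algebraic group is called periodic if all its elements have finite order. Realize $SO_{2n}(\Bbbk)=\{g\in SL_{2n}(\Bbbk)\mid g^T\Omega g=\Omega\}$, where $\Omega$ is the matrix with ones on the secondary diagonal and zeros elsewhere, and let $T=\{\operatorname{diag}(t_1,\ldots,t_n,t_n^{-1},\ldots,t_1^{-1})\mid t_i\in\Bbbk^*\}$, with characters $\chi_j(t)=t_j$, $j=1,\ldots,n$. For $g\in N(T)$ the automorphism $t\mapsto gtg^{-1}$ of $T$ induces an automorphism $A_g$ of the character lattice, $(A_g\lambda)(t)=\lambda(gtg^{-1})$, whose matrix in the basis $\chi_1,\ldots,\chi_n$ is a monomial $(0,1,-1)$-matrix. The component $gT$ corresponds to the pair $(\sigma,\theta)$ determined by $A_g\chi_j=\varepsilon_j\chi_{\sigma(j)}$ for $j=1,\ldots,n$; the pairs arising in this way are exactly those with an even number of $-1$'s in $\theta$. *)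

(* Defs.v *)
From HB Require Import structures.
From mathcomp Require Import all_boot all_order all_algebra all_fingroup.
From mathcomp Require Import boolp classical_sets topology.
From mathcomp Require Import -(notations) mpoly.

Set Implicit Arguments.
Unset Strict Implicit.
Unset Printing Implicit Defensive.

Import GRing.Theory.
Local Open Scope classical_set_scope.
Local Open Scope ring_scope.

(* A copy of the type of m x m matrices carrying the Zariski topology of the
   affine space k^(m * m); the entries of a matrix are its m * m coordinates. *)
Definition zariski (k : fieldType) (m : nat) : Type := 'M[k]_m.

HB.instance Definition _ (k : fieldType) (m : nat) :=
  Choice.on (zariski k m).

Section ZariskiTopology.
Variables (k : fieldType) (m : nat).

Definition zero_locus (S : set (mpoly (m * m) k)) : set (zariski k m) :=
  [set x | forall p, S p -> meval (fun i => mxvec (x : 'M[k]_m) 0 i) p = 0].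

Definition zariski_open (U : set (zariski k m)) : Prop :=
  exists S, ~` U = zero_locus S.

Lemma zariski_openT : zariski_open setT.
Proof.
exists [set (1 : mpoly (m * m) k)]; rewrite setCT; apply/esym/seteqP; split=> // x /(_ 1 erefl) /eqP.
by rewrite rmorph1 oner_eq0.
Qed.

Lemma zariski_openI : setI_closed zariski_open.
Proof.
move=> U V [S eS] [S' eS'].
exists [set r | exists p q, [/\ S p, S' q & r = p * q]].
rewrite setCI eS eS'; apply/seteqP; split=> x.
  move=> + r [p [q [Sp Sq ->]]].
  case=> h; rewrite rmorphM /=.
    by rewrite (h p Sp) mul0r.
  by rewrite (h q Sq) mulr0.
move=> h; have [hS|/existsNP[p /not_implyP[Sp px]]] :=
  pselect (zero_locus S x); first by left.
right=> q Sq; have /eqP : meval (fun i => mxvec (x : 'M_m) 0 i) (p * q) = 0.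
  by apply: h; exists p, q.
by rewrite rmorphM /= mulf_eq0 => /orP[/eqP|/eqP].
Qed.

Lemma zariski_open_bigU (I : Type) (f : I -> set (zariski k m)) :
  (forall i, zariski_open (f i)) -> zariski_open (\bigcup_i f i).
Proof.
move=> of_; exists [set p | exists i, ~` f i `<=` zero_locus [set p]].
rewrite setC_bigcup; apply/seteqP; split=> x.
  by move=> fx p [i hi]; apply: (hi x) => //; exact: fx.
move=> h i _; have [S eS] := of_ i; rewrite eS => p Sp; apply: h.
by exists i; rewrite eS => y hy _ ->; exact: hy.
Qed.

HB.instance Definition _ := isOpenTopological.Build (zariski k m)
  zariski_openT zariski_openI zariski_open_bigU.

End ZariskiTopology.

Section OrthogonalGroup.
Variables (k : fieldType) (n : nat).
Implicit Types (g t : 'M[k]_(n + n)) (lam : 'M[k]_(n + n) -> k).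

Definition Omega : 'M[k]_(n + n) := \matrix_(i, j) (j == rev_ord i)%:R.

Definition SO : set 'M[k]_(n + n) :=
  [set g | \det g = 1 /\ g^T *m Omega *m g = Omega].

Definition torus_elt (t : 'rV[k]_n) : 'M[k]_(n + n) :=
  diag_mx (row_mx t (\row_j (t 0 (rev_ord j))^-1)).

Definition torus : set 'M[k]_(n + n) :=
  [set g | exists2 t : 'rV[k]_n, forall j, t 0 j != 0 & g = torus_elt t].

Definition conj_by g t : 'M[k]_(n + n) := g *m t *m invmx g.

Definition normalizer_torus : set 'M[k]_(n + n) :=
  [set g | SO g /\ conj_by g @` torus = torus].

(* Characters of the torus are represented by functions on matrices, of which
   only the restriction to the torus is meaningful; the (additively written)
   character lattice has z lam = charZ z lam. *)
Definition chi (j : 'I_n) : 'M[k]_(n + n) -> k :=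
  fun t => t (lshift n j) (lshift n j).

Definition charZ (z : int) lam : 'M[k]_(n + n) -> k := fun t => lam t ^ z.

Definition char_act g lam : 'M[k]_(n + n) -> k := fun t => lam (conj_by g t).

Definition is_component (C : set 'M[k]_(n + n)) : Prop :=
  exists2 g, normalizer_torus g &
    C = @connected_component (zariski k (n + n)) normalizer_torus g.

(* The condition depends only on C, not on the choice of g in C. *)
Definition corresponds (C : set 'M[k]_(n + n)) (s : 'S_n) (eps : 'I_n -> int) :=
  exists2 g, C g &
    forall j t, torus t ->
      char_act g (chi j) t = charZ (eps j) (chi (s j)) t.

Definition has_order g (m : nat) : Prop :=
  [/\ (0 < m)%N, g ^+ m = 1 & forall l, (0 < l)%N -> g ^+ l = 1 -> (m <= l)%N].

Definition periodic (C : set 'M[k]_(n + n)) : Prop :=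
  forall g, C g -> exists m, has_order g m.

End OrthogonalGroup.

(* Main.v *)
Require Import Defs.
From mathcomp Require Import all_boot all_order all_algebra all_fingroup.
From mathcomp Require Import boolp classical_sets topology.
From mathcomp Require Import -(notations) mpoly.

(** Points of the torus T are joined to 1 by rational curves
    x |-> (1 + x (t_a - 1))_a, so gT lies in the component of g; conversely the
    matrices of N(T) are monomial, and having a given support is both a closed
    and an open condition on N(T), so all matrices of a component share the
    support attached to (sigma, theta). This support is a signed permutation p of
    the 2n signed indices, and g^T Omega g = Omega says that the entries in rows
    i and -i are inverse to each other. If the signs along a cycle of length l
    multiply to -1, then p^l i = -i, so g^l maps e_i to a multiple of e_{-i} and
    the entries met along the 2l steps cancel in pairs: g^(2l) e_i = e_i.
    Otherwise p^l i = i, and the factor by which g^l scales e_i can be changed at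
    will inside gT, in particular made equal to 2. *)

Set Implicit Arguments.
Unset Strict Implicit.
Unset Printing Implicit Defensive.

Import GRing.Theory.
Local Open Scope ring_scope.

(** * Zariski closed and open conditions on entries; connectedness of rational curves *)

Section ZariskiConnectedness.
Local Open Scope classical_set_scope.
Variables (k : closedFieldType) (m : nat).

Lemma zariski_closed_zero_locus (Z : set (zariski k m)) :
  closed Z <-> exists S, Z = zero_locus S.
Proof. by rewrite -openC /open /= /zariski_open setCK. Qed.

Lemma meval_mpolyX_mxvec (x : 'M[k]_m) i j :
  meval (fun l => mxvec x 0 l) (mpolyX k (mnm1 (mxvec_index i j))) = x i j.
Proof. by rewrite mevalXU mxvecE. Qed.

Lemma closed_zero_entries (E : pred ('I_m * 'I_m)) :
  closed [set x : zariski k m | forall i j, E (i, j) -> (x : 'M_m) i j = 0].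
Proof.
apply/zariski_closed_zero_locus.
exists [set p | exists2 e, E e & p = mpolyX k (mnm1 (mxvec_index e.1 e.2))].
apply/seteqP; split=> x /= xE.
  by move=> _ [[i j] Eij ->]; rewrite meval_mpolyX_mxvec xE.
by move=> i j Eij; rewrite -meval_mpolyX_mxvec; apply: xE; exists (i, j).
Qed.

(** The complement is the hypersurface cut out by the product of the chosen coordinates. *)
Lemma open_nonzero_entries (q : 'I_m -> 'I_m) :
  open [set x : zariski k m | forall i, (x : 'M_m) i (q i) != 0].
Proof.
exists [set \prod_i mpolyX k (mnm1 (mxvec_index i (q i)))].
apply/seteqP; split=> x /=.
  move=> /existsNP [i /negP/negPn xi0] _ ->.
  by rewrite rmorph_prod /= (bigD1 i) //= meval_mpolyX_mxvec (eqP xi0) mul0r.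
move=> /(_ _ erefl) + xN0; rewrite rmorph_prod /= => /eqP /prodf_eq0 [i _].
by rewrite meval_mpolyX_mxvec; apply/negP.
Qed.

(** Membership in the localization of the polynomial ring at [d], with the denominator cleared:
    regular functions on the open set where [d] is nonzero. *)
Definition regular_off (d : {poly k}) (f : k -> k) : Prop :=
  exists N (P : {poly k}), forall x, d.[x] != 0 -> f x * d.[x] ^+ N = P.[x].

Lemma regular_off_poly d (P : {poly k}) : regular_off d (horner P).
Proof. by exists 0%N, P => x _; rewrite mulr1. Qed.

Lemma regular_off_add d f g : regular_off d f -> regular_off d g ->
  regular_off d (fun x => f x + g x).
Proof.
move=> [N [P fP]] [M [Q gQ]]; exists (N + M)%N, (P * d ^+ M + Q * d ^+ N).
move=> x dx; rewrite !hornerE -fP // -gQ // mulrDl exprD.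
by rewrite !mulrA [g x * _ * _]mulrAC.
Qed.

Lemma regular_off_mul d f g : regular_off d f -> regular_off d g ->
  regular_off d (fun x => f x * g x).
Proof.
move=> [N [P fP]] [M [Q gQ]]; exists (N + M)%N, (P * Q).
by move=> x dx; rewrite hornerM -fP // -gQ // exprD mulrACA.
Qed.

Lemma regular_off_exp d f l : regular_off d f ->
  regular_off d (fun x => f x ^+ l).
Proof.
move=> fr; elim: l => [|l IHl].
  by exists 0%N, 1 => x _; rewrite hornerC mulr1.
by have [N [P fP]] := regular_off_mul fr IHl; exists N, P => x; rewrite exprS; apply: fP.
Qed.

(** Off the roots of [d] one has [1 / u = v / d]. *)
Lemma regular_off_inv d (u v : {poly k}) : d = u * v ->
  regular_off d (fun x => u.[x]^-1).
Proof.
move=> ->; exists 1%N, v => x; rewrite hornerM mulf_eq0 negb_or => /andP[ux _].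
by rewrite expr1 mulKf.
Qed.

(** Regular functions form an algebra, so a polynomial equation pulls back along a curve with
    regular coordinates to an equation in one variable. *)
Lemma regular_off_meval r d (p : mpoly r k) (f : 'I_r -> k -> k) :
  (forall i, regular_off d (f i)) ->
  regular_off d (fun x => meval (fun i => f i x) p).
Proof.
move=> fr; under eq_fun do rewrite mevalE.
elim: (msupp p) => [|a s IHs].
  by exists 0%N, 0 => x _; rewrite big_nil mul0r horner0.
under eq_fun do rewrite big_cons.
apply: (regular_off_add _ IHs); apply: regular_off_mul.
  by exists 0%N, (mcoeff a p)%:P => x _; rewrite hornerC mulr1.
elim: (index_enum _) => [|i e IHe].
  by exists 0%N, 1 => x _; rewrite big_nil hornerC mulr1.
under eq_fun do rewrite big_cons.
by apply: (regular_off_mul _ IHe); apply: regular_off_exp.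
Qed.

(* A rational curve is irreducible: two polynomials that do not vanish
   identically on it have a common non-root. *)
Lemma connected_rational_curve (d : {poly k}) (c : k -> 'M[k]_m) :
  (forall i j, regular_off d (fun x => c x i j)) ->
  @connected (zariski k m) [set c x | x in [set x | d.[x] != 0]].
Proof.
move=> creg B [b Bb] [U oU BU] [Z /zariski_closed_zero_locus [S' ZS'] BZ].
have pull p : regular_off d (fun x => meval (fun i => mxvec (c x) 0 i) p).
  apply: (@regular_off_meval _ _ p (fun i x => mxvec (c x) 0 i)) => i.
  by case/mxvec_indexP: i => i j; under eq_fun do rewrite mxvecE.
rewrite BZ; apply/setIidPl => _ [x1 dx1 <-].
rewrite ZS' => q S'q; apply/eqP; apply: contrapT => /negP qx1.
have [S US] := oU.
move: Bb; rewrite BU => -[[x0 dx0 <-] Ux0].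
have [p Sp /eqP px0] : exists2 p, S p & meval (fun i => mxvec (c x0) 0 i) p <> 0.
  have : ~ zero_locus S (c x0) by rewrite -US.
  by move=> /existsNP [p /not_implyP [Sp px0]]; exists p.
have [N [P eP]] := pull p; have [M [Q eQ]] := pull q.
have PQd : P * Q * d != 0.
  rewrite !mulf_neq0 //; apply/negP => /eqP h.
  - move: (eP _ dx0) => /eqP; rewrite h horner0 mulf_eq0 expf_eq0 (negPf dx0).
    by rewrite andbF orbF (negPf px0).
  - move: (eQ _ dx1) => /eqP; rewrite h horner0 mulf_eq0 expf_eq0 (negPf dx1).
    by rewrite andbF orbF (negPf qx1).
  - by move: dx0 => /=; rewrite h horner0 eqxx.
(* At a non-root [x2] of [P * Q * d], nonvanishing of [p] puts [c x2] in [U], hence in [B], where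
   [q] should vanish but does not. *)
have [x2] := closed_nonrootP _ PQd.
rewrite /root !hornerM !mulf_eq0 !negb_or -andbA => /and3P[Px2 Qx2 dx2].
have [Ux2|] := pselect (U (c x2)); last first.
  rewrite -[~ _]/((~` U) (c x2)) US => /(_ p Sp) h.
  by rewrite -eP // h mul0r eqxx in Px2.
have : B (c x2) by rewrite BU; split=> //; exists x2.
rewrite BZ ZS' => -[_ /(_ q S'q) h].
by rewrite -eQ // h mul0r eqxx in Qx2.
Qed.

End ZariskiConnectedness.

(** * Signed indices, signed permutations and the signs along their cycles *)

Section SignedIndices.
Variable n : nat.
Implicit Types (a : 'I_n) (i j : 'I_(n + n)) (b : bool).

(** A boolean stands for a sign and [rev_ord] for negation; every index is uniquely
    [flip b (lshift n a)], that is, plus or minus [a]. *)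
Definition flip b i := if b then rev_ord i else i.

Lemma flip_addb b c i : flip (b (+) c) i = flip b (flip c i).
Proof. by case: b c => [] []; rewrite //= rev_ordK. Qed.

Lemma rev_ord_lshift a : rev_ord (lshift n a) = rshift n (rev_ord a).
Proof. by apply/val_inj; rewrite /= addnBA. Qed.

Lemma flip_lshift_inj b c a a' :
  flip b (lshift n a) = flip c (lshift n a') -> b = c /\ a = a'.
Proof.
case: b c => [] [] /=; rewrite ?rev_ord_lshift => /eqP.
- by rewrite eq_rshift => /eqP /rev_ord_inj.
- by rewrite eq_rlshift.
- by rewrite eq_lrshift.
- by rewrite eq_lshift => /eqP.
Qed.

Variant signed_index_spec : 'I_(n + n) -> Prop :=
  SignedIndex b a : signed_index_spec (flip b (lshift n a)).

Lemma signed_indexP i : signed_index_spec i.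
Proof.
case: (split_ordP i) => a ->; first exact: (SignedIndex false).
by rewrite -[a]rev_ordK -rev_ord_lshift; exact: (SignedIndex true).
Qed.

Lemma rev_ord_neq i : rev_ord i != i.
Proof.
case: (signed_indexP i) => b a; rewrite -[rev_ord _]/(flip true _) -flip_addb.
by apply/eqP => /flip_lshift_inj [] /eqP; case: b.
Qed.

(* With rows indexed so that [rev_ord] is negation, this is the action on
   signed indices of the signed permutation with signs [(-1) ^+ e a]. *)
Definition signed_perm (s : 'S_n) (e : pred 'I_n) i :=
  match split i with
  | inl a => flip (e a) (lshift n (s a))
  | inr a => flip (~~ e (rev_ord a)) (lshift n (s (rev_ord a)))
  end.

Lemma signed_perm_flip s e b a :
  signed_perm s e (flip b (lshift n a)) = flip (b (+) e a) (lshift n (s a)).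
Proof.
rewrite /signed_perm; case: b => /=.
  by rewrite rev_ord_lshift -[rshift _ _]/(unsplit (inr _)) unsplitK rev_ordK.
by rewrite -[lshift _ _]/(unsplit (inl _)) unsplitK.
Qed.

Lemma signed_perm_rev s e i : signed_perm s e (rev_ord i) = rev_ord (signed_perm s e i).
Proof.
case: (signed_indexP i) => b a.
by rewrite -![rev_ord _]/(flip true _) -flip_addb !signed_perm_flip -flip_addb addbA.
Qed.

Lemma signed_perm_inj s e : injective (signed_perm s e).
Proof.
move=> i j; case: (signed_indexP i) (signed_indexP j) => b a [c a'].
rewrite !signed_perm_flip => /flip_lshift_inj [+ /perm_inj aa'].
by rewrite aa' => /addIb ->.
Qed.

Lemma iter_signed_perm_rev s e l i :
  iter l (signed_perm s e) (rev_ord i) = rev_ord (iter l (signed_perm s e) i).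
Proof. by elim: l => //= l ->; rewrite signed_perm_rev. Qed.

(** Parity of the number of minus signs met in the first [l] steps from [a]; over a full cycle it is
    true exactly when the product of signs is -1. *)
Definition twist (s : 'S_n) (e : pred 'I_n) l a :=
  \big[addb/false]_(q < l) e (iter q s a).

Lemma iter_signed_perm s e l b a :
  iter l (signed_perm s e) (flip b (lshift n a)) =
  flip (b (+) twist s e l a) (lshift n (iter l s a)).
Proof.
elim: l => [|l IHl]; first by rewrite /twist big_ord0 addbF.
by rewrite /= IHl signed_perm_flip /twist big_ord_recr /= addbA.
Qed.

Lemma prod_porbit (R : comNzRingType) (s : 'S_n) a (F : 'I_n -> R) :
  \prod_(j in porbit s a) F j = \prod_(q < #|porbit s a|) F (iter q s a).
Proof.
rewrite (eq_bigl _ _ (porbit_traject s a)) -big_uniq ?uniq_traject_porbit //=.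
rewrite (big_nth a) size_traject big_mkord; apply: eq_bigr => q _.
by rewrite nth_traject.
Qed.

Lemma prod_sign_porbit (s : 'S_n) (e : pred 'I_n) a :
  \prod_(j in porbit s a) (-1) ^+ e j = (-1) ^+ twist s e #|porbit s a| a :> int.
Proof.
by rewrite prod_porbit /twist (big_morph (fun b : bool => (-1) ^+ b) (@signr_addb _) (erefl _)).
Qed.

(** The exponent may be reduced modulo the cycle length, and the iterates along one turn of the
    cycle are distinct. *)
Lemma iter_perm_eq (s : 'S_n) l a : (iter l s a == a) = (#|porbit s a| %| l)%N.
Proof.
have L0 : (0 < #|porbit s a|)%N by apply/card_gt0P; exists a; apply: porbit_id.
have iterM r : iter (r * #|porbit s a|) s a = a.
  by elim: r => // r IHr; rewrite mulSn iterD IHr iter_porbit.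
rewrite {1}(divn_eq l #|porbit s a|) addnC iterD iterM /dvdn.
have := ltn_pmod l L0; set r := (_ %% _)%N => rL.
have := nth_uniq a _ _ (uniq_traject_porbit s a).
move=> /(_ r 0%N); rewrite size_traject rL L0 => /(_ erefl erefl) <-.
by rewrite !nth_traject.
Qed.

End SignedIndices.

(** * Powers of matrices with prescribed support *)

Section MonomialMatrices.
Variables (R : comNzRingType) (m : nat).
Implicit Types (p : 'I_m -> 'I_m) (A : 'M[R]_m).

(** The entries in the columns [p i] may vanish too, which makes this a closed condition. *)
Definition supported p A := forall i j, j != p i -> A i j = 0.

(** The scalar picked up along the walk of [l] steps from [i] under [p]. *)
Definition weight p A l i := \prod_(q < l) A (iter q p i) (p (iter q p i)).

Lemma supported_exp p A l i j : supported p A ->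
  (A ^+ l) i j = weight p A l i *+ (j == iter l p i).
Proof.
move=> sA; elim: l i j => [|l IHl] i j.
  by rewrite /weight big_ord0 expr0 mxE eq_sym.
rewrite exprS mxE (bigD1 (p i)) //= big1 ?addr0 => [|q qi]; last first.
  by rewrite sA ?mul0r.
by rewrite IHl -iterSr mulrnAr /weight big_ord_recl; under [in RHS]eq_bigr do rewrite iterSr.
Qed.

Lemma row_expM A (y : R) l r i : row i (A ^+ l) = y *: row i 1%:M ->
  row i (A ^+ (l * r)) = y ^+ r *: row i 1%:M.
Proof.
rewrite exprM; set B := A ^+ l => rB; elim: r => [|r IHr].
  by rewrite !expr0 scale1r.
by rewrite exprS row_mul rB -scalemxAl -row_mul mul1mx IHr scalerA -exprS.
Qed.

End MonomialMatrices.

(** * The torus, its normalizer, and translation by the torus inside a component *)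

Section Torus.
Variables (k : closedFieldType) (n : nat).
Implicit Types (g h : 'M[k]_(n + n)) (t : 'rV[k]_n) (i j : 'I_(n + n)).

Local Notation N := (@normalizer_torus k n).

Definition torus_diag t : 'rV[k]_(n + n) := row_mx t (\row_j (t 0 (rev_ord j))^-1).

Lemma torus_diag_lshift t a : torus_diag t 0 (lshift n a) = t 0 a.
Proof. by rewrite /torus_diag row_mxEl. Qed.

Lemma torus_diag_rev t i : torus_diag t 0 (rev_ord i) = (torus_diag t 0 i)^-1.
Proof.
have dr a : torus_diag t 0 (rev_ord (lshift n a)) = (t 0 a)^-1.
  by rewrite rev_ord_lshift /torus_diag row_mxEr mxE rev_ordK.
by case: (signed_indexP i) => -[] a /=; rewrite ?rev_ordK ?torus_diag_lshift dr ?invrK.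
Qed.

Lemma torus_diag_neq0 t i : (forall a, t 0 a != 0) -> torus_diag t 0 i != 0.
Proof.
move=> t0; case: (signed_indexP i) => -[] a /=.
  by rewrite torus_diag_rev torus_diag_lshift invr_eq0.
by rewrite torus_diag_lshift.
Qed.

Lemma mulmx_torus_elt g t i j : (g *m torus_elt t) i j = g i j * torus_diag t 0 j.
Proof. by rewrite mul_mx_diag mxE. Qed.

Lemma torus_elt_mulmx g t i j : (torus_elt t *m g) i j = torus_diag t 0 i * g i j.
Proof. by rewrite mul_diag_mx mxE. Qed.

Lemma torus_elt_comm t u : torus_elt t *m torus_elt u = torus_elt u *m torus_elt t.
Proof. exact: diag_mxC. Qed.

Lemma torus_elt_SO t : (forall a, t 0 a != 0) -> SO (torus_elt t).
Proof.
move=> t0; split.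
  rewrite det_diag big_split_ord /= [X in _ * X](reindex_inj rev_ord_inj) /=.
  rewrite -big_split big1 //= => a _.
  by rewrite row_mxEl row_mxEr mxE rev_ordK mulfV.
apply/matrixP => i j; rewrite mulmx_torus_elt tr_diag_mx torus_elt_mulmx.
  rewrite ![Omega _ _ _ _]mxE.
have [->|_] := eqVneq j (rev_ord i); last by rewrite mulr0 mul0r.
by rewrite mulr1 torus_diag_rev mulfV // torus_diag_neq0.
Qed.

Lemma SO_mul g h : SO g -> SO h -> SO (g *m h).
Proof.
move=> [dg gO] [dh hO]; split; first by rewrite det_mulmx dg dh mulr1.
by rewrite trmx_mul !mulmxA -(mulmxA h^T) -(mulmxA h^T) gO.
Qed.

Lemma SO_unitmx g : SO g -> g \in unitmx.
Proof. by move=> [dg _]; rewrite unitmxE dg unitr1. Qed.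

Lemma conj_by_eq g u v : g \in unitmx -> (conj_by g u = v) <-> (g *m u = v *m g).
Proof.
move=> gU; split=> [<-|guv]; first by rewrite /conj_by mulmxKV.
by rewrite /conj_by guv mulmxK.
Qed.

(** The torus being commutative, the product conjugates it exactly as [g] does. *)
Lemma normalizer_mul_torus g t : N g -> (forall a, t 0 a != 0) ->
  N (g *m torus_elt t).
Proof.
move=> [SOg gT] t0; have SOgt := SO_mul SOg (torus_elt_SO t0).
split=> //; rewrite -[RHS]gT; apply: eq_imagel => _ [u u0 ->].
apply/conj_by_eq; first exact: SO_unitmx.
by rewrite mulmxA -mulmxA torus_elt_comm mulmxA /conj_by mulmxKV // SO_unitmx.
Qed.

Lemma component_mul_torus g t : N g -> (forall a, t 0 a != 0) ->
  @connected_component (zariski k (n + n)) N g (g *m torus_elt t).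
Proof.
(* The coordinates run affinely from 1 to [t]; [d] excludes the parameters where one of them
   vanishes, and 0 and 1 are not excluded. *)
move=> Ng t0; pose u a : {poly k} := 1 + 'X * (t 0 a - 1)%:P.
pose d := \prod_a u a; pose c x := g *m torus_elt (\row_a (u a).[x]).
have uN0 x a : d.[x] != 0 -> (u a).[x] != 0.
  by rewrite horner_prod => /prodf_neq0 /(_ a erefl).
have u0 a : (u a).[0] = 1 by rewrite hornerD hornerM hornerX !hornerC mul0r addr0.
have u1 a : (u a).[1] = t 0 a by rewrite hornerD hornerM hornerX !hornerC mul1r addrC subrK.
have cN : ([set c x | x in [set x | d.[x] != 0]] `<=` N)%classic.
  by move=> _ [x /= dx <-]; apply: normalizer_mul_torus => // a; rewrite mxE uN0.
have c0 : c 0 = g.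
  apply/matrixP => i j; rewrite mulmx_torus_elt.
  case: (signed_indexP j) => -[] a /=.
    by rewrite torus_diag_rev torus_diag_lshift mxE u0 invr1 mulr1.
  by rewrite torus_diag_lshift mxE u0 mulr1.
have c1 : c 1 = g *m torus_elt t.
  by congr (_ *m torus_elt _); apply/rowP => a; rewrite mxE u1.
apply: (@connected_component_max (zariski k (n + n)) _ _ _ _ cN).
- by exists 0; rewrite ?c0 //= horner_prod big1 ?oner_eq0.
- apply: connected_rational_curve => i j.
  under eq_fun do rewrite mulmx_torus_elt.
  apply: regular_off_mul.
    by exists 0%N, (g i j)%:P => x _; rewrite hornerC mulr1.
  case: (signed_indexP j) => -[] a /=; last first.
    under eq_fun do rewrite torus_diag_lshift mxE; exact: regular_off_poly.
  under eq_fun do rewrite torus_diag_rev torus_diag_lshift mxE.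
  by apply: (@regular_off_inv _ _ _ (\prod_(b | b != a) u b)); rewrite /d (bigD1 a).
- by exists 1; rewrite ?c1 //= horner_prod; apply/prodf_neq0 => a _; rewrite u1.
Qed.

(** * Separation of torus weights and constancy of the support on a component *)

Definition bump_row (y : k) (a : 'I_n) : 'rV[k]_n := \row_b (if b == a then y else 1).

Lemma bump_row_neq0 y a b : y != 0 -> bump_row y a 0 b != 0.
Proof. by move=> y0; rewrite mxE; case: ifP => // _; apply: oner_neq0. Qed.

Lemma torus_diag_bump y a c b : torus_diag (bump_row y a) 0 (flip c (lshift n b)) =
  if b == a then if c then y^-1 else y else 1.
Proof.
by case: c => /=; rewrite ?torus_diag_rev torus_diag_lshift mxE; case: ifP; rewrite ?invr1.
Qed.

(** The 2n weights are distinguished by setting one coordinate to 2 and the others to 1, since 2,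
    1/2 and 1 are distinct in characteristic zero. *)
Lemma torus_diag_separates i j : [pchar k] =i pred0 ->
  (forall t, (forall a, t 0 a != 0) -> torus_diag t 0 i = torus_diag t 0 j) -> i = j.
Proof.
move=> /pcharf0P char0; have two0 : (2 : k) != 0 by rewrite char0.
have two1 : (2 : k) != 1 by rewrite -subr_eq0 -[X in _ - X]/(1%:R) -natrB // char0.
have four1 : (2 : k) != 2^-1.
  apply/eqP => /(congr1 ( *%R^~ 2)); rewrite mulVf // => /eqP.
  by rewrite -natrM -subr_eq0 -[X in _ - X]/(1%:R) -natrB // char0.
case: (signed_indexP i) (signed_indexP j) => b a [c a'].
move=> /(_ (bump_row 2 a) (fun _ => bump_row_neq0 _ _ two0)) /eqP.
rewrite !torus_diag_bump eqxx; have [->|_] := eqVneq a' a; last first.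
  by case: b; rewrite ?invr_eq1 (negPf two1).
by case: b c => [] []; rewrite // ?(negPf four1) // eq_sym (negPf four1).
Qed.

Lemma normalizer_torus_elt g t : N g -> (forall a, t 0 a != 0) ->
  exists2 t' : 'rV[k]_n, (forall a, t' 0 a != 0) & conj_by g (torus_elt t) = torus_elt t'.
Proof.
move=> [_ gT] t0; have : torus (conj_by g (torus_elt t)).
  by rewrite -gT; exists (torus_elt t) => //; exists t.
by move=> [t' ? ->]; exists t'.
Qed.

(** Compare the entries at [(i, j)] in [g t = t' g] and cancel [g i j]. *)
Lemma conj_torus_elt g t t' i j : N g ->
  conj_by g (torus_elt t) = torus_elt t' -> g i j != 0 ->
  torus_diag t 0 j = torus_diag t' 0 i.
Proof.
move=> [SOg _] /conj_by_eq-/(_ (SO_unitmx SOg)) /matrixP /(_ i j).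
by rewrite mulmx_torus_elt torus_elt_mulmx mulrC => /mulIf; apply.
Qed.

(** Columns with nonzero entries in one row carry the same weight of the torus, hence coincide. *)
Lemma normalizer_row_unique g i j l : [pchar k] =i pred0 -> N g ->
  g i j != 0 -> g i l != 0 -> j = l.
Proof.
move=> char0 Ng gij gil; apply: torus_diag_separates => // t t0.
have [t' _ gt] := normalizer_torus_elt Ng t0.
by rewrite (conj_torus_elt Ng gt gij) (conj_torus_elt Ng gt gil).
Qed.

Lemma supported_unit_neq0 p g i : SO g -> supported p g -> g i (p i) != 0.
Proof.
move=> [dg _] sg; apply/eqP => gi; move: dg.
rewrite (expand_det_row _ i) big1 => [/esym/eqP|j _]; first by rewrite oner_eq0.
by have [->|/sg ->] := eqVneq j (p i); rewrite ?gi mul0r.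
Qed.

(** As rows have a single nonzero entry, vanishing off the graph of [p] and nonvanishing on it
    define the same subset of [C]. It is closed, open and contains [g], so it is all of [C]. *)
Lemma component_supported p g g0 h : [pchar k] =i pred0 ->
  let C := @connected_component (zariski k (n + n)) N g0 in
  C g -> supported p g -> C h -> supported p h.
Proof.
move=> char0 C Cg sg; have CN : (C `<=` N)%classic by exact: connected_component_sub.
pose E := [pred ij : 'I_(n + n) * 'I_(n + n) | ij.2 != p ij.1].
pose Z := [set x : zariski k (n + n) | forall i j, E (i, j) -> (x : 'M_(n + n)) i j = 0]%classic.
pose U := [set x : zariski k (n + n) | forall i, (x : 'M_(n + n)) i (p i) != 0]%classic.
have UZ : (C `&` Z = C `&` U)%classic.
  apply/seteqP; split=> x [Cx xZ]; split=> //.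
    by move=> i; apply: (@supported_unit_neq0 p) => //; case: (CN _ Cx).
  move=> i j /= jp; apply/eqP; apply: contraNT jp => xij.
  by rewrite (normalizer_row_unique char0 (CN _ Cx) xij (xZ i)).
have CZ : (C `&` Z)%classic = C.
  apply: (@component_connected (zariski k (n + n)) N g0).
  - by exists g.
  - by exists U; [exact: open_nonzero_entries|].
  - by exists Z; [exact: closed_zero_entries|].
by rewrite -CZ => -[].
Qed.

End Torus.

(** * Orders of signed monomial matrices: twisted and untwisted cycles *)

Section SignedMonomialOrder.
Variables (k : closedFieldType) (n : nat) (s : 'S_n) (e : pred 'I_n).
Implicit Types (g : 'M[k]_(n + n)) (a : 'I_n) (i j : 'I_(n + n)).

Local Notation p := (signed_perm s e).
Local Notation L a := #|porbit s a|.

(** This is the entry at [(p i, p (rev_ord i))] of the orthogonality relation, where a single term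
    survives. *)
Lemma SO_supported_rev g i : SO g -> supported p g ->
  g i (p i) * g (rev_ord i) (p (rev_ord i)) = 1.
Proof.
move=> [_ /matrixP /(_ (p i) (p (rev_ord i)))] + sg.
rewrite -mulmxA mxE (bigD1 i) //= big1 ?addr0 => [|a ai]; last first.
  by rewrite mxE sg ?mul0r // (inj_eq (@signed_perm_inj n s e)) eq_sym.
rewrite !mxE signed_perm_rev eqxx (bigD1 (rev_ord i)) //= big1 ?addr0 => [|a ai].
  by rewrite mxE eqxx mul1r.
by rewrite mxE (negPf ai) mul0r.
Qed.

(** The second turn round the cycle runs through the negatives of the first, so each factor meets
    its inverse. *)
Lemma row_exp_twisted g b a : SO g -> supported p g -> twist s e (L a) a ->
  row (flip b (lshift n a)) (g ^+ (L a).*2) = row (flip b (lshift n a)) 1%:M.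
Proof.
move=> SOg sg tw; set i := flip b _.
have pL : iter (L a) p i = rev_ord i.
  by rewrite iter_signed_perm iter_porbit tw addbC flip_addb.
apply/rowP => j; rewrite !mxE (supported_exp _ _ _ sg) -addnn iterD pL.
rewrite iter_signed_perm_rev pL rev_ordK [j == i]eq_sym /weight big_split_ord /=.
rewrite -big_split big1 //= => q _.
by rewrite addnC iterD pL iter_signed_perm_rev SO_supported_rev.
Qed.

Lemma has_order_twisted g : (0 < n)%N -> SO g -> supported p g ->
  (forall a, twist s e (L a) a) ->
  has_order g (2 * \big[lcmn/1%N]_(c in porbits s) #|c|)%N.
Proof.
move=> n0 SOg sg tw; set M := \big[_/_]_(_ in _) _.
have LM a : (L a %| M)%N.
  by rewrite /M (bigD1 (porbit s a)) ?imset_f //= dvdn_lcml.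
split.
- rewrite muln_gt0 /=; rewrite /M; elim/big_rec: _ => // c l /imsetP[a _ ->] l0.
  by rewrite lcmn_gt0 l0 andbT; apply/card_gt0P; exists a; apply: porbit_id.
- apply/row_matrixP => i; case: (signed_indexP i) => b a.
  have /divnK <- := LM a; rewrite mulnCA mulnC mul2n.
  rewrite (@row_expM _ _ _ 1) ?expr1n ?scale1r //.
  exact: row_exp_twisted.
- move=> l l0 gl; apply: dvdn_leq => //.
  have fixed a : iter l p (lshift n a) = lshift n a.
    move: gl => /matrixP /(_ (lshift n a) (lshift n a)).
    rewrite (supported_exp _ _ _ sg) mxE eqxx; case: eqP => //= _ /esym/eqP.
    by rewrite mulr1n mulr0n oner_eq0.
  (* With [l = r * L a], each turn reverses the sign, so fixing [a] with its sign forces [r] to be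
     even. *)
  have Ll a : ((L a).*2 %| l)%N.
    have := fixed a; rewrite (iter_signed_perm s e l false) addFb.
    move=> /(@flip_lshift_inj n _ false)[_ /eqP]; rewrite iter_perm_eq => /dvdnP[r lr].
    have odd_fix : iter l p (lshift n a) = flip (odd r) (lshift n a).
      rewrite lr; elim: {lr} r => //= r IHr; rewrite mulSn iterD IHr.
      by rewrite iter_signed_perm tw iter_porbit addbT.
    move: odd_fix; rewrite fixed => /(@flip_lshift_inj n false)[/esym/negbT even_r _].
    by rewrite lr -mul2n dvdn_pmul2r ?dvdn2 //; apply/card_gt0P; exists a; apply: porbit_id.
  (* Since [n > 0] there is a cycle, so [l] is even; divisibility by the lcm is then tested on
     [l / 2]. *)
  have l2 : (2 %| l)%N.
    by apply: dvdn_trans (Ll (Ordinal n0)); rewrite -mul2n dvdn_mulr.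
  rewrite -(divnK l2) mulnC dvdn_pmul2r //; apply/dvdn_biglcmP => c /imsetP[a _ ->].
  by rewrite -(@dvdn_pmul2r 2) // divnK // muln2.
Qed.

(* Rescaling the column of [lshift n a], which an untwisted cycle meets once,
   makes [2] an eigenvalue of [g ^+ L a]. *)
Lemma untwisted_infinite_order g a : [pchar k] =i pred0 ->
  SO g -> supported p g -> ~~ twist s e (L a) a ->
  exists2 t : 'rV[k]_n, (forall b, t 0 b != 0) &
    forall m, ~ has_order (g *m torus_elt t) m.
Proof.
move=> /pcharf0P char0 SOg sg /negbTE tw; set i := lshift n a.
pose w := weight p g (L a) i.
have w0 : w != 0 by apply/prodf_neq0 => q _; apply: supported_unit_neq0.
have y0 : 2 / w != 0 by rewrite mulf_neq0 ?invr_eq0 ?char0.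
(* The value [2 / w] replaces the factor [w] of the cycle by 2. *)
exists (bump_row (2 / w) a) => [b|m]; first exact: bump_row_neq0.
set h := _ *m _; move=> [m0 hm _].
have sh : supported p h by move=> x j /sg gxj; rewrite mulmx_torus_elt gxj mul0r.
have pL : iter (L a) p i = i.
  by rewrite (iter_signed_perm s e (L a) false) iter_porbit tw.
have wh : weight p h (L a) i = 2.
  rewrite /weight; under eq_bigr do rewrite mulmx_torus_elt.
  rewrite big_split /= -/(weight p g (L a) i) -/w.
  (* The walk returns to plus or minus [a] only at its last step, and there to [i] itself; all other
     factors are 1. *)
  suff -> : \prod_(q < L a) torus_diag (bump_row (2 / w) a) 0 (p (iter q p i)) = 2 / w.
    by rewrite mulrC divfK.
  have : (0 < L a)%N by apply/card_gt0P; exists a; apply: porbit_id.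
  case eL : (L a) => [//|l] _; rewrite big_ord_recr big1 /= => [|q _].
    rewrite mul1r -iterS -eL pL.
    by rewrite (@torus_diag_bump _ _ _ _ false) eqxx.
  rewrite -iterS (iter_signed_perm s e _ false) torus_diag_bump iter_perm_eq eL.
  by rewrite gtnNdvd // ltnS.
have hL : row i (h ^+ L a) = 2 *: row i 1%:M.
  apply/rowP => j; rewrite !mxE (supported_exp _ _ _ sh) wh pL [i == j]eq_sym.
  by rewrite mulr_natr.
(* If [h ^+ m = 1], then [2 ^ m = 1] with [m > 0], contrary to characteristic zero. *)
have /rowP /(_ i) := row_expM m hL.
rewrite mulnC exprM hm expr1n !mxE eqxx mulr1 => /esym/eqP.
rewrite -natrX -subr_eq0 -[X in _ - X]/(1%:R) -natrB ?expn_gt0 // char0 subn_eq0.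
by rewrite leqNgt -{1}(expn0 2) ltn_exp2l // m0.
Qed.

End SignedMonomialOrder.

(** * From the pair of a component to the support of its matrices, and the periodicity criterion *)

Lemma corresponding_supported (k : closedFieldType) (n : nat) (s : 'S_n)
    (eps : 'I_n -> int) (g : 'M[k]_(n + n)) :
  [pchar k] =i pred0 -> (forall j, eps j = 1 \/ eps j = -1) ->
  normalizer_torus g ->
  (forall j t, torus t -> char_act g (chi j) t = charZ (eps j) (chi (s j)) t) ->
  supported (signed_perm s (fun a => eps a == -1)) g.
Proof.
move=> char0 eps_sign Ng act i j; apply: contraNeq => gij.
apply/eqP/torus_diag_separates => // t t0.
have [t' _ gt] := normalizer_torus_elt Ng t0.
rewrite (conj_torus_elt Ng gt gij).
have diag_flip (u : 'rV[k]_n) b x :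
    torus_diag u 0 (flip b x) = if b then (torus_diag u 0 x)^-1 else torus_diag u 0 x.
  by case: b; rewrite //= torus_diag_rev.
have chiE (u : 'rV[k]_n) a : chi a (torus_elt u) = u 0 a.
  by rewrite /chi mxE eqxx -[row_mx _ _]/(torus_diag u) torus_diag_lshift.
case: (signed_indexP i) => b a; rewrite signed_perm_flip !diag_flip !torus_diag_lshift.
(* The action on characters gives the coordinate [a] of [t'] as that of [t] at [s a], inverted when
   [eps a = -1]: the weight of column [p i]. *)
have := act a (torus_elt t) (ex_intro2 _ _ t t0 erefl).
rewrite /char_act /charZ gt !chiE => ->.
by case: (eps_sign a) => ->; case: b; rewrite ?eqxx //= ?expr1z ?exprN1 ?invrK.
Qed.

Theorem mainTheorem9 (k : closedFieldType) (char0 : [pchar k] =i pred0)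
    (n : nat) (n_ge1 : (1 <= n)%N)
    (s : 'S_n) (eps : 'I_n -> int)
    (eps_sign : forall j, eps j = 1 \/ eps j = -1)
    (eps_even : ~~ odd #|[pred j | eps j == -1]|)
    (C : set 'M[k]_(n + n)) (C_comp : is_component C)
    (C_pair : corresponds C s eps) :
  (periodic C <->
     (forall c : {set 'I_n}, c \in porbits s -> \prod_(j in c) eps j = -1)) /\
  (periodic C ->
     forall g, C g ->
       has_order g (2 * \big[lcmn/1%N]_(c in porbits s) #|c|)%N).
Proof.
pose e a := eps a == -1.
have epsE a : eps a = (-1) ^+ e a by rewrite /e; case: (eps_sign a) => ->.
have [g0 Ng0 CE] := C_comp; have [g Cg act] := C_pair.
have CN h : C h -> normalizer_torus h.
  by rewrite CE; apply: connected_component_sub.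
have sC h : C h -> supported (signed_perm s e) h.
  move: (Cg); rewrite CE => Cg'; apply: (component_supported char0 Cg').
  by apply: corresponding_supported act => //; apply: CN; rewrite CE.
have orderC : (forall a, twist s e #|porbit s a| a) -> forall h, C h ->
    has_order h (2 * \big[lcmn/1%N]_(c in porbits s) #|c|)%N.
  by move=> tw h Ch; apply: has_order_twisted (sC h Ch) tw => //; case: (CN h Ch).
(* An untwisted cycle would yield a translate of [g] by the torus that has infinite order and still
   lies in [C]. *)
have periodic_twist : periodic C -> forall a, twist s e #|porbit s a| a.
  move=> perC a; apply: contraT => /(untwisted_infinite_order char0 _ (sC g Cg)).
  have [SOg _] := CN g Cg; case=> // t t0 infinite.
  have [|m /infinite//] := perC (g *m torus_elt t).
  move: (Cg); rewrite CE => /same_connected_component ->.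
  by apply: component_mul_torus => //; apply: CN.
have prodE a : (\prod_(j in porbit s a) eps j == -1) = twist s e #|porbit s a| a.
  under eq_bigr do rewrite epsE.
  by rewrite prod_sign_porbit; case: (twist _ _ _ _).
split; last by move=> /periodic_twist/orderC.
split=> [/periodic_twist tw c /imsetP[a _ ->]|prodC h Ch].
  by apply/eqP; rewrite prodE.
exists (2 * \big[lcmn/1%N]_(c in porbits s) #|c|)%N; apply: orderC => // a.
by rewrite -prodE prodC // imset_f.
Qed.
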